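(* Let $0<r\le\frac{\sqrt3}{2}$ and $0<\alpha\le\pi$. Then a $C_\alpha C_\pi$ path (that is, an $L_\alpha R_\pi$ path or an $R_\alpha L_\pi$ path), starting at any configuration $g_0\in SO(3)$, is non-optimal for the free terminal orientation problem: there is an admissible path of strictly smaller length from $g_0$ to the same final location.
   Context: Dubins vehicle on the unit sphere. Fix $r\in(0,1)$ and put $U_{max}=\frac{\sqrt{1-r^2}}{r}$, so $r=\frac{1}{\sqrt{1+U_{max}^2}}$. A configuration is a rotation matrix $g=(\mathbf X\ \ \mathbf T\ \ \mathbf N)\in SO(3)$ with columns $\mathbf X$ (location on the unit sphere $S^2\subset\mathbb R^3$), $\mathbf T$ (unit tangent, heading) and $\mathbf N=\mathbf X\times\mathbf T$. An admissible path of length $L\ge 0$ starting at $g_0$ is an absolutely continuous curve $g:[0,L]\to SO(3)$, $g(0)=g_0$, satisfying, for some measurable control $u_g:[0,L]\to[-U_{max},U_{max}]$, $$\mathbf X'=\mathbf T,\qquad \mathbf T'=-\mathbf X+u_g\mathbf N,\qquad \mathbf N'=-u_g\mathbf T$$ for almost every $s$. Its final location is $\mathbf X(L)$; in the free terminal orientation problem only the initial configuration and the final location are prescribed, and length is minimized. Segments: an $L$ (left) segment has $u_g\equiv U_{max}$ and an $R$ (right) segment has $u_g\equiv -U_{max}$; an $L$ or $R$ segment of arc angle $\phi$ has length $r\phi$. $C$ denotes either $L$ or $R$; in $CC$ the two segments are of opposite type. $L_\alpha R_\pi$ means an $L$ segment of arc angle $\alpha$ followed by an $R$ segment of arc angle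 $\pi$, and similarly for $R_\alpha L_\pi$. *)

(* Defs.v *)
From HB Require Import structures.
From mathcomp Require Import all_boot all_order all_algebra.
From mathcomp Require Import all_classical all_reals all_analysis.

Set Implicit Arguments.
Unset Strict Implicit.
Unset Printing Implicit Defensive.

Import Order.TTheory GRing.Theory Num.Theory.
Import numFieldNormedType.Exports.

Local Open Scope classical_set_scope.
Local Open Scope ring_scope.

(* The test intervals may be degenerate and may share end points; only the
   values of f on [a, b] are used. *)
Definition abs_continuous (R : realType) (V : normedModType R) (a b : R)
    (f : R -> V) : Prop :=
  forall e : R, 0 < e -> exists2 d : R, 0 < d &
    forall (n : nat) (I : 'I_n -> R * R),
      (forall i, a <= (I i).1 /\ (I i).1 <= (I i).2 /\ (I i).2 <= b) ->
      trivIset setT (fun i => [set` `](I i).1, (I i).2[]) ->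
      \sum_(i < n) ((I i).2 - (I i).1) < d ->
      \sum_(i < n) `|f (I i).2 - f (I i).1| < e.

Definition SO3 (R : realType) : set 'M[R]_3 :=
  [set g | g^T *m g = 1%:M /\ \det g = 1].

(* On SO3 the third column is automatically the cross product of the first
   two, so that normal g = location g x heading g. *)
Definition location (R : realType) (g : 'M[R]_3) : 'cV[R]_3 := col 0 g.
Definition heading (R : realType) (g : 'M[R]_3) : 'cV[R]_3 := col 1 g.
Definition normal (R : realType) (g : 'M[R]_3) : 'cV[R]_3 := col 2 g.

Definition Umax (R : realType) (r : R) : R := Num.sqrt (1 - r ^+ 2) / r.

Definition dubins_ode_at (R : realType) (u : R -> R) (g : R -> 'M[R]_3)
    (s : R) : Prop :=
  [/\ is_derive s 1 (fun t => location (g t)) (heading (g s)),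
      is_derive s 1 (fun t => heading (g t))
        (- location (g s) + u s *: normal (g s)) &
      is_derive s 1 (fun t => normal (g t)) (- (u s *: heading (g s)))].

(* The curve g and the control u are total functions, of which only the
   restrictions to [0, L] matter; the equations are imposed almost everywhere
   on the open interval because derivatives at 0 and L would involve values
   outside [0, L]. *)
Definition dubins_path (R : realType) (r L : R) (g0 : 'M[R]_3)
    (u : R -> R) (g : R -> 'M[R]_3) : Prop :=
  [/\ 0 <= L,
      measurable_fun `[0, L] u /\
        (forall s, 0 <= s <= L -> - Umax r <= u s <= Umax r),
      (forall s, 0 <= s <= L -> SO3 (g s)) /\ abs_continuous 0 L g,
      g 0 = g0 &
      {ae @lebesgue_measure R, forall s : R, 0 < s < L ->
        dubins_ode_at u g s}].

Definition admissible_path (R : realType) (r L : R) (g0 : 'M[R]_3)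
    (g : R -> 'M[R]_3) : Prop :=
  exists u : R -> R, dubins_path r L g0 u g.

Inductive turn : Type := Left | Right.

Definition opposite (c : turn) : turn :=
  match c with Left => Right | Right => Left end.

Definition turn_control (R : realType) (r : R) (c : turn) : R :=
  match c with Left => Umax r | Right => - Umax r end.

(* A turn of arc angle phi has length r * phi. The control is left free
   at the junction of the two segments and at the end points. *)
Definition CC_path (R : realType) (r : R) (c : turn) (alpha beta : R)
    (g0 : 'M[R]_3) (g : R -> 'M[R]_3) : Prop :=
  exists u : R -> R,
    [/\ dubins_path r (r * alpha + r * beta) g0 u g,
        forall s, 0 < s < r * alpha -> u s = turn_control r c &
        forall s, r * alpha < s < r * alpha + r * beta ->
          u s = turn_control r (opposite c)].

Definition non_optimal (R : realType) (r L : R) (g0 : 'M[R]_3)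
    (g : R -> 'M[R]_3) : Prop :=
  exists (L' : R) (g' : R -> 'M[R]_3),
    [/\ admissible_path r L' g0 g', L' < L &
        location (g' L') = location (g L)].

(* Main.v *)
(* Let A^t denote the rotation by t about the axis of the first circle and q the
   end point of a half turn of the second type, so that the path ends at
   A^alpha q = A^(alpha - psi) (A^psi q). The point A^psi q can be reached from
   the starting point by a single arc of some admissible curvature v, whose
   turning angle is at most pi and whose radius exceeds r by a factor
   1 + O(psi^2) only. Hence for small psi the last arc gets longer by O(psi^2),
   while r psi is saved on the first one. The bound on r enters as
   3 - 4 r^2 >= 0.
   The given path is identified with a product of rotations through the fact
   that an absolutely continuous function whose derivative vanishes almost
   everywhere is constant. *)
Require Import Defs.
From mathcomp Require Import all_boot all_order all_algebra.
From mathcomp Require Import all_classical all_reals all_analysis.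
From mathcomp Require Import measurable_realfun.
From mathcomp Require Import ring lra.

Set Implicit Arguments.
Unset Strict Implicit.
Unset Printing Implicit Defensive.

Import Order.TTheory GRing.Theory Num.Theory.
Import numFieldNormedType.Exports.
Local Open Scope ring_scope.
Local Open Scope classical_set_scope.

(** * Absolutely continuous functions *)

Lemma is_derive0_near (R : realType) (f : R -> R) (s e : R) : 0 < e ->
  is_derive s 1 f 0 ->
  exists2 h, 0 < h & forall y, `|y - s| < h -> `|f y - f s| <= e * `|y - s|.
Proof.
move=> e0 [df f0].
have : (h^-1 *: (f (h *: 1 + s) - f s)) @[h --> 0^'] --> 'D_1 f s.
  exact: df.
rewrite f0 => /cvgrPdist_le /(_ e e0) [h /= h0 hP].
exists h => // y ysh; have [->|ys] := eqVneq y s; first by rewrite !subrr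
  normr0 mulr0.
have := hP (y - s); rewrite /= sub0r normrN => /(_ ysh).
rewrite subr_eq0 => /(_ ys); rewrite [_ *: 1]mulr1 subrK sub0r
  normrN normrM normfV.
by rewrite mulrC ler_pdivrMr ?normr_gt0 ?subr_eq0.
Qed.

Lemma sum_itv_le_measure (R : realType) (n : nat) (I : 'I_n -> R * R)
    (U : set R) (d : R) : measurable U -> (lebesgue_measure U < d%:E)%E ->
  (forall i, (I i).1 <= (I i).2) -> (forall i, `](I i).1, (I i).2[ `<=` U) ->
  trivIset setT (fun i => `](I i).1, (I i).2[) ->
  \sum_(i < n) ((I i).2 - (I i).1) < d.
Proof.
move=> mU Ud I12 IU tI.
pose J i : set R := `](I i).1, (I i).2[.
have muJ i : lebesgue_measure (J i) = ((I i).2 - (I i).1)%:E.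
  rewrite lebesgue_measure_itv/= lte_fin.
  have := I12 i; rewrite le_eqVlt => /predU1P[->|->]; last by rewrite -EFinB.
  by rewrite ltxx subrr.
rewrite -lte_fin; apply: le_lt_trans Ud.
rewrite -sumEFin (eq_bigr (fun i => lebesgue_measure (J i)))//.
have mJ i : measurable (J i) by exact: measurable_itv.
rewrite -measure_bigsetU_ord//.
apply: le_measure; [apply/mem_set|exact/mem_set|].
- by apply: bigsetU_measurable => i _; exact: mJ.
- apply: (big_ind (fun A => A `<=` U)) => [|A B AU BU|i _]; last exact: IU.
    exact: sub0set.
  by move=> x [/AU|/BU].
Qed.

Definition rcons_fun (T : Type) n (I : 'I_n -> T) (x : T) (i : 'I_n.+1) : T :=
  oapp I x (unlift ord_max i).

Lemma rcons_fun_max (T : Type) n (I : 'I_n -> T) x : rcons_fun I x ord_max = x.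
Proof. by rewrite /rcons_fun unlift_none. Qed.

Lemma rcons_fun_lift (T : Type) n (I : 'I_n -> T) x j :
  rcons_fun I x (lift ord_max j) = I j.
Proof. by rewrite /rcons_fun liftK. Qed.

(** The exceptional null set lies in an open [U] of measure below the modulus [d], so increments
    over disjoint intervals inside [U] add up to less than [e / 2]; the remaining increments are
    small because the derivative vanishes. A supremum argument combines the two, with no Vitali
    covering or integration. *)
Lemma abs_continuous_ae_derive0 (R : realType) (a b : R) (f : R -> R) :
  a <= b -> abs_continuous a b f ->
  {ae @lebesgue_measure R, forall s, a < s < b -> is_derive s 1 f 0} ->
  f b = f a.
Proof.
move=> ab acf aef; apply/eqP; rewrite -subr_eq0 -normr_le0.
apply/ler_addgt0Pr => e e0; rewrite add0r.
have ba : 0 <= b - a by rewrite subr_ge0.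
(* Half of [e] is spent on the points with zero derivative; the added 1 keeps the denominator
   positive when [a = b]. *)
pose e1 := e / 2 / (b - a + 1).
have e10 : 0 < e1 by rewrite !divr_gt0// ltr_wpDl.
have e1e : e1 * (b - a) <= e / 2.
  rewrite /e1 -mulrA ler_piMr ?divr_ge0 ?ltW// mulrC ltr_pdivrMr ?mul1r; lra.
have [d d0 acd] := acf (e / 2) (divr_gt0 e0 (ltr0Sn _ 1)).
have [U [oU ZU Ud]] : exists U : set R, [/\ open U,
    [set s | ~ (a < s < b /\ is_derive s 1 f 0)] `&` `[a, b] `<=` U &
    (lebesgue_measure U < d%:E)%E].
  have neg1 (x : R) : (@lebesgue_measure R).-negligible [set x].
    by apply/negligibleP => //; exact: lebesgue_measure_set1.
  (* The end points, where nothing is assumed about the derivative, join the null set before it is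
     enclosed in [U] by outer regularity. *)
  have [N [mN N0 ZN]] := negligibleU aef (negligibleU (neg1 a) (neg1 b)).
  have [|U [oU NU Ud]] := @lebesgue_regularity_outer R N d mN _ d0.
    by rewrite [X in (X < _)%E]N0.
  exists U; split=> //.
    move=> s [sP]; rewrite /= in_itv/= => /andP[sa sb]; apply/NU/ZN.
    have [->|sna] := eqVneq s a; first by right; left.
    have [->|snb] := eqVneq s b; first by right; right.
    left => /= dP; apply: sP; have sab : a < s < b.
      by rewrite !lt_neqAle sa sb (eq_sym a) sna snb.
    by split=> //; exact: dP.
  have mU : measurable U by exact: open_measurable.
  have -> : lebesgue_measure U =
      (lebesgue_measure (U `\` N) + lebesgue_measure (U `&` N))%E.
    exact: measureDI.
  rewrite (_ : lebesgue_measure (U `&` N) = 0%E) ?adde0//.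
  apply: (subset_measure0 _ mN _ N0); last exact: subIsetr.
  exact: measurableI.
(* Increments near a point with zero derivative cost at most e1 per unit of
   length; all others are taken over disjoint intervals inside U. The supremum of
   the points reached in this way is b. *)
pose P x := exists n (I : 'I_n -> R * R), [/\
  forall i, a <= (I i).1 /\ (I i).1 <= (I i).2 /\ (I i).2 <= x,
  trivIset setT (fun i => `](I i).1, (I i).2[),
  forall i, `](I i).1, (I i).2[ `<=` U &
  `|f x - f a| <= e1 * (x - a) + \sum_(i < n) `|f (I i).2 - f (I i).1|].
suff [n [I [Iab tI IU fI]]] : P b.
  apply: le_trans fI _; rewrite [leRHS]splitr lerD// ltW//.
  apply: (acd n I Iab).
    move: tI; congr (trivIset _ _); apply/funext => i; by rewrite set_mem_set.
  apply: (@sum_itv_le_measure _ _ _ U) => //; last first.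
    by move=> i; have [_ []] := Iab i.
  exact: open_measurable.
(* [P] passes across [s]. If the derivative at [s] is zero, the family stays the same and the
   increment is split at [s]; otherwise [s] is in [U] and, for small [h], the interval from [x] to
   [y] can be appended to the family. *)
have step s : a <= s <= b -> exists2 h, 0 < h & forall x y,
    s - h < x -> x <= s -> s <= y -> y < s + h -> a <= x -> y <= b ->
    P x -> P y.
  move=> sab.
  have [[sab' ds]|ns] := pselect (a < s < b /\ is_derive s 1 f 0).
    have [h h0 hP] := is_derive0_near e10 ds.
    exists h => // x y shx xs sy ysh ax yb [n [I [Iax tI IU fI]]].
    exists n, I; split=> //.
      move=> i; have [? [? ?]] := Iax i; split=> //; split=> //.
      by rewrite (le_trans _ (le_trans xs sy)).
    have fx : `|f x - f s| <= e1 * `|x - s|.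
      by apply: hP; rewrite distrC ger0_norm; lra.
    have fy : `|f y - f s| <= e1 * `|y - s|.
      by apply: hP; rewrite ger0_norm; lra.
    rewrite (le_trans (ler_distD (f x) _ _))//.
    rewrite (le_trans (lerD (ler_distD (f s) _ _) fI))//.
    rewrite distrC in fx.
    rewrite (le_trans (lerD (lerD fy fx) (lexx _)))//.
    rewrite ger0_norm ?subr_ge0// distrC ger0_norm ?subr_ge0//.
    by rewrite le_eqVlt; apply/orP; left; apply/eqP; ring.
  have Us : U s by apply: ZU; split=> //; rewrite /= in_itv.
  have /nbhs_ballP[h /= h0 hU] : nbhs s U by exact: open_nbhs_nbhs.
  exists h => // x y shx xs sy ysh ax yb [n [I [Iax tI IU fI]]].
  have xy := le_trans xs sy.
  exists n.+1, (rcons_fun I (x, y)); split.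
  - move=> i; case: (unliftP ord_max i) => [j|] ->.
      rewrite rcons_fun_lift; have [? [? ?]] := Iax j; split=> //; split=> //.
      exact: le_trans xy.
    by rewrite rcons_fun_max.
  - move=> i j _ _; case: (unliftP ord_max i) => [i'|] ->;
      case: (unliftP ord_max j) => [j'|] ->;
      rewrite ?rcons_fun_max ?rcons_fun_lift //.
    + by move=> /tI -> .
    + move=> [z [/=]]; rewrite !in_itv/= => /andP[_ zi] /andP[xz _].
      have [_ [_ ix]] := Iax i'.
      by have := lt_trans xz (lt_le_trans zi ix); rewrite ltxx.
    + move=> [z [/=]]; rewrite !in_itv/= => /andP[xz _] /andP[_ zi].
      have [_ [_ ix]] := Iax j'.
      by have := lt_trans xz (lt_le_trans zi ix); rewrite ltxx.
  - move=> i; case: (unliftP ord_max i) => [j|] ->.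
      by rewrite rcons_fun_lift.
    rewrite rcons_fun_max/= => z /=; rewrite in_itv/= => /andP[xz zy].
    apply: hU.
    by rewrite /ball/= distrC ltr_distl; lra.
  - rewrite big_ord_recr/= rcons_fun_max/=.
    rewrite (eq_bigr (fun i => `|f (I i).2 - f (I i).1|)); last first.
      move=> i _; rewrite (_ : widen_ord _ i = lift ord_max i)
        ?rcons_fun_lift//.
      by apply/val_inj; rewrite /= /bump leqNgt ltn_ord.
    rewrite (le_trans (ler_distD (f x) _ _))// [leLHS]addrC addrA lerD2r.
    rewrite (le_trans fI)// lerD2r ler_pM2l// lerD2r//.
pose S := [set x | a <= x <= b /\ P x].
have Sa : S a.
  split; first by rewrite lexx.
  exists 0%N, (fun=> (0, 0)); split=> [[]//||[]//|]; first by move=> [].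
  by rewrite big_ord0 !subrr normr0 mulr0 addr0.
have hS : has_sup S by split; [exists a|exists b => x [/andP[]]].
set s := sup S.
have sab : a <= s <= b.
  apply/andP; split; first exact: ub_le_sup hS.2 _ Sa.
  by apply: ge_sup; [exists a|move=> x [/andP[]]].
have [h h0 hP] := step s sab.
have [x [/andP[ax xb] Px] sx] := sup_adherent h0 hS.
have xs : x <= s by apply: ub_le_sup hS.2 _ _; split => //; rewrite ax xb.
(* [y] is again a point of [S], hence at most [s]; this excludes [s + h / 2] and leaves [y = b]. *)
pose y := Num.min (s + h / 2) b.
have sy : s <= y by rewrite le_min; lra.
have yb : y <= b by rewrite ge_min lexx orbT.
have ysh : y < s + h by rewrite gt_min; apply/orP; left; lra.
have Py : P y by apply: (hP x) => //.
have ys : y <= s.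
  apply: ub_le_sup hS.2 _ _; split => //.
  by rewrite yb andbT (le_trans ax)// (le_trans xs).
have [shb|bsh] := leP (s + h / 2) b.
  by move: ys; rewrite /y (min_idPl shb); lra.
by move: Py; rewrite /y (min_idPr (ltW bsh)).
Qed.

Lemma abs_continuous_dominated (R : realType) (V W : normedModType R)
    (a b C : R) (g : R -> V) (f : R -> W) : abs_continuous a b g ->
  (forall x y, a <= x -> x <= y -> y <= b ->
     `|f y - f x| <= C * (y - x) + C * `|g y - g x|) ->
  abs_continuous a b f.
Proof.
move=> acg fg e e0.
have C0 : 0 < `|C| + 1 by rewrite ltr_wpDl.
(* Both sums will be at most [e1], for a total cost of at most twice [|C| e1], which is below [e].
   Dividing by [|C| + 1] also covers [C = 0]. *)
pose e1 := e / 2 / (`|C| + 1).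
have e10 : 0 < e1 by rewrite !divr_gt0.
have Ce : `|C| * e1 < e / 2.
  by rewrite /e1 mulrCA gtr_pMr ?divr_gt0// ltr_pdivrMr// mul1r ltrDl.
have [d d0 gd] := acg e1 e10.
exists (Num.min d e1) => [|n I Iab tI Id]; first by rewrite lt_min d0.
move: Id; rewrite lt_min => /andP[Id Ie].
have {}gd := gd n I Iab tI Id.
pose X := \sum_(i < n) ((I i).2 - (I i).1) +
  \sum_(i < n) `|g (I i).2 - g (I i).1|.
have X0 : 0 <= X.
  rewrite addr_ge0// sumr_ge0// => i _; rewrite subr_ge0.
  by have [_ []] := Iab i.
apply: (@le_lt_trans _ _ (`|C| * X)).
  rewrite /X -big_split/= mulr_sumr; apply: ler_sum => i _.
  have [aI [I12 Ib]] := Iab i.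
  rewrite (le_trans (fg _ _ aI I12 Ib))// -mulrDr ler_wpM2r ?ler_norm//.
  by rewrite addr_ge0// subr_ge0.
rewrite (@le_lt_trans _ _ (`|C| * (e1 + e1)))//.
  by rewrite ler_wpM2l// lerD ?ltW.
by rewrite mulrDr; lra.
Qed.

Lemma abs_continuous_lipschitz (R : realType) (V : normedModType R) (a b K : R)
    (g : R -> V) : 0 <= K ->
  (forall x y, x <= y -> `|g y - g x| <= K * (y - x)) ->
  abs_continuous a b g.
Proof.
move=> K0 gK; apply: (@abs_continuous_dominated _ R^o V _ _ K id).
  move=> e e0; exists e => // n I Iab tI; apply: le_lt_trans.
  apply: ler_sum => i _; have [_ [I12 _]] := Iab i.
  by rewrite ger0_norm ?subr_ge0.
move=> x y _ xy _; rewrite (le_trans (gK x y xy))// lerDl mulr_ge0//.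
Qed.

(** If [c] separates [x] from [y], the triangle inequality passes through the common value at [c];
    [K + K'] dominates both constants. *)
Lemma lipschitz_glue (R : realType) (V : normedModType R)
    (p q : R -> V) (c K K' : R) :
  0 <= K -> 0 <= K' -> p c = q c ->
  (forall x y, x <= y -> `|p y - p x| <= K * (y - x)) ->
  (forall x y, x <= y -> `|q y - q x| <= K' * (y - x)) ->
  forall x y, x <= y ->
    `|(if y <= c then p y else q y) - (if x <= c then p x else q x)| <=
    (K + K') * (y - x).
Proof.
move=> K0 K'0 pq pK qK x y xy; have yx : 0 <= y - x by rewrite subr_ge0.
have [yc|cy] := leP y c.
  rewrite (le_trans xy yc) (le_trans (pK x y xy))// ler_wpM2r// lerDl//.
have [xc|cx] := leP x c; last first.
  by rewrite (le_trans (qK x y xy))// ler_wpM2r// lerDr.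
rewrite (le_trans (ler_distD (p c) _ _))// {1}pq.
rewrite (le_trans (lerD (qK c y (ltW cy)) (pK x c xc)))//.
rewrite addrC mulrDl lerD// ler_wpM2l//; first by rewrite lerD2r ltW.
by rewrite lerD2l lerN2.
Qed.

Lemma lipschitz1_of_derive (R : realType) (f df : R -> R) (x y : R) :
  (forall z : R, is_derive z 1 f (df z)) -> (forall z, `|df z| <= 1) ->
  x <= y -> `|f y - f x| <= y - x.
Proof.
move=> fdf df1 xy.
have cf : {within `[x, y], continuous f}.
  apply: continuous_subspaceT => z; apply/differentiable_continuous.
  by apply/derivable1_diffP; case: (fdf z).
have [c _ ->] := MVT_segment xy (fun z _ => fdf z) cf.
by rewrite normrM (ger0_norm (_ : 0 <= y - x)) ?subr_ge0// ler_piMl// subr_ge0.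
Qed.

Lemma sin_lipschitz (R : realType) (x y : R) :
  x <= y -> `|sin y - sin x| <= y - x.
Proof. by apply: (@lipschitz1_of_derive _ _ cos) => z; rewrite ?cos_max. Qed.

Lemma cos_lipschitz (R : realType) (x y : R) :
  x <= y -> `|cos y - cos x| <= y - x.
Proof.
apply: (@lipschitz1_of_derive _ _ (fun z => - sin z)) => z.
by rewrite normrN sin_max.
Qed.

(** * Rotations with constant geodesic curvature *)

Section Turning.
Context {R : realType}.
Implicit Types (u s x y : R) (M : 'M[R]_3).

Lemma sum3 (F : 'I_3 -> R) : \sum_i F i = F 0 + F 1 + F 2.
Proof.
rewrite !big_ord_recl big_ord0 addr0 addrA.
by congr (F _ + F _ + F _); apply/val_inj.
Qed.

Lemma ord3_ind (P : 'I_3 -> Prop) : P 0 -> P 1 -> P 2 -> forall i, P i.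
Proof.
move=> P0 P1 P2 [[|[|[|//]]] i3].
- by rewrite (_ : Ordinal i3 = 0)//; exact/val_inj.
- by rewrite (_ : Ordinal i3 = 1)//; exact/val_inj.
- by rewrite (_ : Ordinal i3 = 2)//; exact/val_inj.
Qed.

(* The equations of motion read g' = g *m spin u. Since spin u satisfies
   A^3 = - (1 + u^2) A, Rodrigues' formula gives their flow [turning] below. *)
Definition spin u : 'M[R]_3 :=
  delta_mx 1 0 - delta_mx 0 1 + u *: (delta_mx 2 1 - delta_mx 1 2).

Lemma tr_spin u : (spin u)^T = - spin u.
Proof.
apply/matrixP => i j; rewrite /spin !mxE ![(j == _) && _]andbC; ring.
Qed.

Lemma mul_spinE m (M : 'M[R]_(m, 3)) u i :
  ((M *m spin u) i 0 = M i 1) * ((M *m spin u) i 1 = - M i 0 + u * M i 2) *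
  ((M *m spin u) i 2 = - (u * M i 1)).
Proof.
by split; [split|]; rewrite mxE sum3 !mxE /=; ring.
Qed.

Lemma mul_spin3 m (M : 'M[R]_(m, 3)) u :
  M *m spin u *m spin u *m spin u = - (1 + u ^+ 2) *: (M *m spin u).
Proof.
apply/matrixP => i j; move: j.
by apply: ord3_ind; rewrite [RHS]mxE !mul_spinE; ring.
Qed.

(** Multiplication of quadratic polynomials in A modulo A^3 = - w A, hence A^4 = - w A^2. It reduces
    the group law of [turning] to the addition formulas for sine and cosine. *)
Lemma mul_quadratic_of_cubic n (A : 'M[R]_n) w a b a' b' :
  A *m A *m A = - w *: A ->
  (1%:M + a *: A + b *: (A *m A)) *m (1%:M + a' *: A + b' *: (A *m A)) =
  1%:M + (a + a' - w * (a * b' + a' * b)) *: A +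
  (b + b' + a * a' - w * (b * b')) *: (A *m A).
Proof.
move=> A3.
rewrite !mulmxDr !mulmxDl !mul1mx !mulmx1 -!scalemxAl -!scalemxAr !mulmxA.
rewrite A3 -scalemxAl; apply/matrixP => i j; rewrite !mxE; ring.
Qed.

(** Angular speed along a circle of geodesic curvature u: the Euclidean radius of that circle is 1 /
    [freq u], and the nonzero eigenvalues of [spin u] are plus and minus i [freq u]. *)
Definition freq u : R := Num.sqrt (1 + u ^+ 2).

Lemma freq_gt0 u : 0 < freq u.
Proof. by rewrite sqrtr_gt0 ltr_pwDl// sqr_ge0. Qed.

Lemma sqr_freq u : freq u ^+ 2 = 1 + u ^+ 2.
Proof. by rewrite sqr_sqrtr// addr_ge0// sqr_ge0. Qed.

Definition turning u s : 'M[R]_3 :=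
  1%:M + (sin (freq u * s) / freq u) *: spin u +
  ((1 - cos (freq u * s)) / freq u ^+ 2) *: (spin u *m spin u).

Lemma turningD u s x : turning u (s + x) = turning u s *m turning u x.
Proof.
have A3 : spin u *m spin u *m spin u = - (freq u ^+ 2) *: spin u.
  by rewrite -[X in X *m _ *m _]mul1mx mul_spin3 mul1mx sqr_freq.
rewrite /turning (mul_quadratic_of_cubic _ _ _ _ A3) mulrDr sinD cosD.
have w0 := lt0r_neq0 (freq_gt0 u).
by congr (1%:M + _ *: _ + _ *: _); field.
Qed.

Lemma turning0 u : turning u 0 = 1%:M.
Proof. by rewrite /turning mulr0 sin0 cos0 subrr !mul0r !scale0r !addr0. Qed.

Lemma tr_turning u s : (turning u s)^T = turning u (- s).
Proof.
rewrite /turning mulrN sinN cosN; move: (spin u) (tr_spin u) => A trA.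
rewrite linearD/= linearD/= linearZ/= linearZ/= trmx_mul trA trmx1.
by rewrite mulNmx mulmxN opprK mulNr scalerN scaleNr.
Qed.

Lemma turningVK u s : turning u (- s) *m turning u s = 1%:M.
Proof. by rewrite -turningD addNr turning0. Qed.

(** Orthogonality only gives a determinant of square 1; it equals 1 because [turning u s] is the
    square of the turning by s / 2. *)
Lemma turning_SO3 u s : SO3 (turning u s).
Proof.
split; first by rewrite tr_turning turningVK.
have d x : \det (turning u x) ^+ 2 = 1.
  by rewrite expr2 -[X in X * _]det_tr -det_mulmx tr_turning turningVK det1.
by rewrite (splitr s) turningD det_mulmx -expr2 d.
Qed.

Lemma mul_SO3 M (N : 'M[R]_3) : SO3 M -> SO3 N -> SO3 (M *m N).
Proof.
move=> [MM dM] [NN dN]; split; last by rewrite det_mulmx dM dN mulr1.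
by rewrite trmx_mul mulmxA -(mulmxA N^T) MM mulmx1.
Qed.

(** Coordinates in the initial frame. The third one is u times 1 minus the first, so the curvature
    of an arc can be read off the point reached; the shortcut is found in this way. *)
Lemma location_turning u s : let h := (1 - cos (freq u * s)) / freq u ^+ 2 in
  (location (turning u s) 0 0 = 1 - h) *
  (location (turning u s) 1 0 = sin (freq u * s) / freq u) *
  (location (turning u s) 2 0 = u * h).
Proof.
move=> h.
have e i : location (turning u s) i 0 = (turning u s) i 0 by rewrite mxE.
rewrite !e /turning; set a := _ / _; set A := spin u.
by split; [split|]; rewrite !mxE sum3 !mxE /=; rewrite -/h; ring.
Qed.
Lemma mulmx_location M (N : 'M[R]_3) : location (M *m N) = M *m location N.
Proof. by rewrite /location colE -mulmxA -colE. Qed.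

End Turning.

(** * Derivatives of matrix-valued curves and the matrix form of the equations *)

Lemma is_derive_mxP (R : realType) m n (M : R -> 'M[R]_(m, n)) (s : R) dM :
  is_derive s 1 M dM <->
  forall i j, is_derive s 1 (fun t => M t i j) (dM i j).
Proof.
split=> [[Ms <-] i j|h].
  by split; [move/derivable_mxP : Ms; exact|rewrite derive_mx// mxE].
have Ms : derivable M s 1 by apply/derivable_mxP => i j; case: (h i j).
split=> //; rewrite derive_mx//; apply/matrixP => i j; rewrite mxE.
by case: (h i j).
Qed.

Lemma is_derive_mulmx (R : realType) m n p (A : R -> 'M[R]_(m, n))
    (B : R -> 'M[R]_(n, p)) (s : R) dA dB :
  is_derive s 1 A dA -> is_derive s 1 B dB ->
  is_derive s 1 (fun t => A t *m B t) (dA *m B s + A s *m dB).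
Proof.
move=> /is_derive_mxP hA /is_derive_mxP hB; apply/is_derive_mxP => i j.
have -> : (fun t => (A t *m B t) i j) =
    \sum_k (fun t => A t i k) * (fun t => B t k j).
  by apply/funext => t; rewrite mxE fct_sumE.
apply: is_derive_eq; rewrite !mxE -big_split/=; apply: eq_bigr => k _.
by rewrite /GRing.scale/=; ring.
Qed.

Lemma is_derive_trmx (R : realType) m n (M : R -> 'M[R]_(m, n)) (s : R) dM :
  is_derive s 1 M dM -> is_derive s 1 (fun t => (M t)^T) dM^T.
Proof.
move=> /is_derive_mxP h; apply/is_derive_mxP => i j; rewrite mxE.
by under eq_fun do rewrite mxE.
Qed.

Lemma is_derive_turning (R : realType) (u s : R) :
  is_derive s 1 (turning u) (turning u s *m spin u).
Proof.
have A3 := mul_spin3 (1%:M) u; rewrite !mul1mx in A3.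
have -> : turning u s *m spin u = cos (freq u * s) *: spin u +
    (sin (freq u * s) / freq u) *: (spin u *m spin u).
  have w0 := lt0r_neq0 (freq_gt0 u).
  rewrite /turning; move: (spin u) A3 => A A3.
  rewrite !mulmxDl mul1mx -!scalemxAl A3 -sqr_freq scalerA.
  by apply/matrixP => i j; rewrite !mxE; field.
apply/is_derive_mxP => i j; rewrite /turning.
move: (spin u *m spin u) (spin u) => B A.
under eq_fun do rewrite !mxE; rewrite !mxE.
have w0 := lt0r_neq0 (freq_gt0 u).
apply: is_derive_eq.
by rewrite /GRing.scale/=; field.
Qed.

(** Packs the three column equations into one linear matrix equation, to which the product rule
    applies. *)
Lemma dubins_ode_atP (R : realType) (u : R -> R) (g : R -> 'M[R]_3) (s : R) :
  dubins_ode_at u g s <-> is_derive s 1 g (g s *m spin (u s)).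
Proof.
have e (t : R) i j : (col j (g t)) i 0 = g t i j by rewrite mxE.
split=> [[/is_derive_mxP h0 /is_derive_mxP h1 /is_derive_mxP h2]|
         /is_derive_mxP h].
- apply/is_derive_mxP => i; apply: ord3_ind; rewrite mul_spinE.
  + have := h0 i 0; rewrite /location /heading.
    by under eq_fun do rewrite mxE; rewrite mxE.
  + have := h1 i 0; rewrite /location /heading /normal.
    by under eq_fun do rewrite mxE; rewrite !mxE.
  + have := h2 i 0; rewrite /heading /normal.
    by under eq_fun do rewrite mxE; rewrite !mxE.
- split; apply/is_derive_mxP => i j; rewrite !(mxE, ord1).
  all: rewrite /location /heading /normal.
  + by under eq_fun do rewrite mxE; have := h i 0; rewrite mul_spinE.
  + by under eq_fun do rewrite mxE; have := h i 1; rewrite mul_spinE.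
  + by under eq_fun do rewrite mxE; have := h i 2; rewrite mul_spinE.
Qed.

(** * Norm estimates, uniqueness of the flow, concatenation of two arcs *)

Lemma ler_mx_entry (R : realType) m n (A : 'M[R]_(m, n)) i j : `|A i j| <= `|A|.
Proof.
rewrite [leRHS]/Num.Def.normr/= mx_normrE.
exact: (le_bigmax _ (fun ij : 'I_m * 'I_n => `|A ij.1 ij.2|) (i, j)).
Qed.

Lemma mx_norm_le (R : realType) m n (A : 'M[R]_(m, n)) (e : R) : 0 <= e ->
  (forall i j, `|A i j| <= e) -> `|A| <= e.
Proof.
move=> e0 Ae; rewrite [leLHS]/Num.Def.normr/= mx_normrE.
by apply: bigmax_le => // -[i j] _; exact: Ae.
Qed.

(** The norm is the largest absolute entry, which is not submultiplicative; the factor counts the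
    terms in an entry of the product. *)
Lemma mx_norm_mul (R : realType) m n p (A : 'M[R]_(m, n)) (B : 'M[R]_(n, p)) :
  `|A *m B| <= n%:R * (`|A| * `|B|).
Proof.
apply: mx_norm_le => [|i j]; first by rewrite !mulr_ge0.
rewrite mxE (le_trans (ler_norm_sum _ _ _))//.
rewrite (le_trans (ler_sum _ (fun k _ => _ : _ <= `|A| * `|B|)))//.
  by move=> k; rewrite normrM ler_pM// ler_mx_entry.
by rewrite sumr_const card_ord mulr_natl.
Qed.

(** The columns are unit vectors. *)
Lemma SO3_norm_le1 (R : realType) (g : 'M[R]_3) : SO3 g -> `|g| <= 1.
Proof.
move=> [gg _]; apply: mx_norm_le => // k i.
have /matrixP/(_ i i) := gg; rewrite !mxE eqxx mulr1n => gi.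
rewrite -(ler_pXn2r (n := 2)) ?nnegrE// expr1n -gi.
rewrite (bigD1 k)//= mxE -normrX ger0_norm ?sqr_ge0// expr2.
rewrite lerDl sumr_ge0// => l _.
by rewrite mxE -expr2 sqr_ge0.
Qed.

Lemma turning_lipschitz (R : realType) (M : 'M[R]_3) (u : R) :
  exists2 K, 0 <= K & forall x y, x <= y ->
    `|M *m turning u y - M *m turning u x| <= K * (y - x).
Proof.
have w0 := freq_gt0 u; have w00 := lt0r_neq0 w0.
exists (`|M *m spin u| + `|M *m (spin u *m spin u)| / freq u) => [|x y xy].
  by rewrite addr_ge0// divr_ge0// ltW.
have -> : M *m turning u y - M *m turning u x =
    ((sin (freq u * y) - sin (freq u * x)) / freq u) *: (M *m spin u) -
    ((cos (freq u * y) - cos (freq u * x)) / freq u ^+ 2) *: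
      (M *m (spin u *m spin u)).
  rewrite /turning; move: (spin u *m spin u) (spin u) => B A.
  rewrite !mulmxDr !mulmx1 -!scalemxAr.
  by apply/matrixP => i j; rewrite !mxE; ring.
have wxy : freq u * x <= freq u * y by rewrite ler_pM2l.
rewrite (le_trans (ler_normB _ _))//.
have normVf (z t : R) : 0 < t -> `|z / t| = `|z| / t.
  by move=> t0; rewrite normrM normfV (gtr0_norm t0).
rewrite (normrZ _ (M *m spin u)) (normrZ _ (M *m (spin u *m spin u))).
rewrite !normVf ?exprn_gt0// mulrDl lerD//.
  rewrite mulrC ler_wpM2l// ler_pdivrMr// (le_trans (sin_lipschitz wxy))//.
  by rewrite -mulrBr mulrC.
rewrite mulrC -mulrA ler_wpM2l// ler_pdivrMr ?exprn_gt0//.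
rewrite (le_trans (cos_lipschitz wxy))// -mulrBr.
by rewrite le_eqVlt; apply/orP; left; apply/eqP; field.
Qed.

(** The product [F] of g with the inverse flow has zero derivative almost everywhere, the two terms
    of the product rule cancelling; its entries are absolutely continuous, hence take equal values
    at a and b. *)
Lemma turning_unique (R : realType) (k a b : R) (g : R -> 'M[R]_3) : a <= b ->
  abs_continuous a b g -> (forall s, a <= s <= b -> SO3 (g s)) ->
  {ae @lebesgue_measure R, forall s, a < s < b ->
    is_derive s 1 g (g s *m spin k)} ->
  g b = g a *m turning k (b - a).
Proof.
move=> ab acg gSO gae.
pose F s := g s *m turning k (- s).
have [K K0 kK] := turning_lipschitz 1%:M k.
have tE x : turning k (- x) = (turning k x)^T by rewrite tr_turning.
have acF i j : abs_continuous a b (fun s => F s i j).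
  apply: (@abs_continuous_dominated _ _ _ _ _ (3 + 3 * K) g) => // x y ax xy yb.
  have -> : F y i j - F x i j = (F y - F x) i j by rewrite !mxE.
  have -> : F y - F x = (g y - g x) *m turning k (- y) +
      g x *m (turning k (- y) - turning k (- x)).
    by rewrite /F mulmxBl mulmxBr addrA subrK.
  rewrite (le_trans (ler_mx_entry _ _ _))// (le_trans (ler_normD _ _))//.
  have gx : `|g x| <= 1 by apply/SO3_norm_le1/gSO; rewrite ax (le_trans xy).
  have ty : `|turning k (- y)| <= 1 by exact/SO3_norm_le1/turning_SO3.
  have txy : `|turning k (- y) - turning k (- x)| <= K * (y - x).
    have := kK (- y) (- x); rewrite lerN2 !mul1mx => /(_ xy).
    by rewrite opprK [- x + y]addrC distrC.
  have gyx : `|(g y - g x) *m turning k (- y)| <= 3 * `|g y - g x|.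
    by rewrite (le_trans (mx_norm_mul _ _))// ler_wpM2l// ler_piMr.
  have gxt : `|g x *m (turning k (- y) - turning k (- x))| <= 3 * (K * (y - x)).
    by rewrite (le_trans (mx_norm_mul _ _))// ler_wpM2l//
      (le_trans _ txy)// ler_piMl.
  apply: (le_trans (lerD gyx gxt)); rewrite -subr_ge0.
  set z := `|g y - g x|.
  rewrite (_ : _ - _ = 3 * (y - x) + 3 * (K * z)); last by ring.
  have z0 : 0 <= z by exact: normr_ge0.
  by rewrite addr_ge0 ?mulr_ge0 ?subr_ge0.
have Fba : F b = F a.
  apply/matrixP => i j; apply: abs_continuous_ae_derive0 (acF i j) _ => //.
  apply: negligibleS gae; apply: subsetC => s /= gs sab.
  (* Transposing the flow differentiates its inverse and puts [spin k] on the left, where it meets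
     the [spin k] from the derivative of [g]. *)
  have dT : is_derive s 1 (fun t => turning k (- t))
      (- (spin k *m turning k (- s))).
    under eq_fun do rewrite tE.
    have -> : - (spin k *m turning k (- s)) = (turning k s *m spin k)^T.
      by rewrite trmx_mul tr_spin mulNmx tE.
    exact: is_derive_trmx (is_derive_turning k s).
  have := is_derive_mulmx (gs sab) dT.
  by rewrite mulmxN mulmxA addrN => /is_derive_mxP/(_ i j); rewrite mxE.
have := congr1 (mulmx^~ (turning k b)) Fba.
rewrite /F /= -!mulmxA turningVK mulmx1 => ->.
by rewrite -turningD addrC.
Qed.

Lemma turning_pair_admissible (R : realType) (r s1 s2 u1 u2 : R)
    (g0 : 'M[R]_3) :
  SO3 g0 -> 0 <= s1 -> 0 <= s2 -> `|u1| <= Umax r -> `|u2| <= Umax r ->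
  exists2 g, admissible_path r (s1 + s2) g0 g &
    g (s1 + s2) = g0 *m turning u1 s1 *m turning u2 s2.
Proof.
move=> g0S s10 s20 u1U u2U.
(* The factor [turning u2 (- s1)] lets the second arc be parametrized by total time while agreeing
   with the first at [s1]. *)
pose M2 := g0 *m (turning u1 s1 *m turning u2 (- s1)).
pose g s := if s <= s1 then g0 *m turning u1 s else M2 *m turning u2 s.
pose u s := if s <= s1 then u1 else u2.
have M2S : SO3 M2 by do 2?apply: mul_SO3 => //; exact: turning_SO3.
have glue : g0 *m turning u1 s1 = M2 *m turning u2 s1.
  by rewrite /M2 -!mulmxA turningVK mulmx1.
have gE s : 0 <= s -> g (s1 + s) = g0 *m turning u1 s1 *m turning u2 s.
  move=> s0; have [->|sn0] := eqVneq s 0.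
    by rewrite addr0 turning0 mulmx1 /g lexx.
  rewrite /g ifF; last first.
    by apply/negbTE; rewrite -ltNge ltrDl lt_neqAle eq_sym sn0.
  by rewrite turningD mulmxA -glue.
exists g; last exact: gE.
exists u; split.
- exact: addr_ge0.
- split.
    apply: measurable_funTS; apply: measurable_fun_ifT => //.
    by apply: measurable_fun_ler => //; exact: measurable_id.
  by move=> s _; rewrite -ler_norml /u; case: ifP.
- split=> [s _|].
    by rewrite /g; case: ifP => _; apply: mul_SO3 => //; exact: turning_SO3.
  have [K1 K10 L1] := turning_lipschitz g0 u1.
  have [K2 K20 L2] := turning_lipschitz M2 u2.
  apply: (@abs_continuous_lipschitz _ _ _ _ (K1 + K2)); first exact: addr_ge0.
  exact: lipschitz_glue K10 K20 glue L1 L2.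
- by rewrite /g s10 turning0 mulmx1.
(* The equations can fail only at the junction [s1]. *)
- have neg1 : (@lebesgue_measure R).-negligible [set s1].
    by apply/negligibleP => //; exact: lebesgue_measure_set1.
  apply: negligibleS neg1 => s /= ns; apply: contrapT => ss1; apply: ns => _.
  have dM (M : 'M[R]_3) v : is_derive s 1 (fun t => M *m turning v t)
      (M *m turning v s *m spin v).
    have := is_derive_mulmx (is_derive_cst M s 1) (is_derive_turning v s).
    by rewrite mul0mx add0r mulmxA.
  apply/dubins_ode_atP; rewrite /g /u.
  have [ls|ls] := leP s s1.
    have {}ls : s < s1 by rewrite lt_neqAle ls andbT; apply/eqP.
    apply: (near_eq_is_derive _ (dM _ _)).
    near=> t; rewrite ifT// ltW//; near: t; exact: lt_nbhsl.
  apply: (near_eq_is_derive _ (dM _ _)).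
  near=> t; rewrite ifF//; apply/negbTE; rewrite -ltNge.
  by near: t; exact: lt_nbhsr.
Unshelve. all: by end_near. Qed.

Lemma spin_mulE (R : realType) m (M : 'M[R]_(3, m)) u j :
  ((spin u *m M) 0 j = - M 1 j) * ((spin u *m M) 1 j = M 0 j - u * M 2 j) *
  ((spin u *m M) 2 j = u * M 1 j).
Proof. by split; [split|]; rewrite mxE sum3 !mxE /=; ring. Qed.

(** Rodrigues' formula with [spin u] applied twice instead of squared, so that [spin_mulE] evaluates
    every entry. *)
Lemma turning_mulE (R : realType) m (M : 'M[R]_(3, m)) u s i j :
  (turning u s *m M) i j =
  M i j + sin (freq u * s) / freq u * (spin u *m M) i j +
  (1 - cos (freq u * s)) / freq u ^+ 2 * (spin u *m (spin u *m M)) i j.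
Proof.
rewrite /turning; move: (spin u) => A.
rewrite !mulmxDl mul1mx -!scalemxAl -mulmxA.
by move: (A *m M) (A *m (A *m M)) => B C; rewrite !mxE.
Qed.

Lemma freq_Umax (R : realType) (r : R) :
  0 < r -> r <= 1 -> freq (Umax r) = r^-1.
Proof.
move=> r0 r1; rewrite /freq /Umax expr_div_n sqr_sqrtr; last first.
  by rewrite subr_ge0 expr_le1// ltW.
rewrite -[RHS]ger0_norm ?invr_ge0 ?ltW// -sqrtr_sqr; congr Num.sqrt.
by have r00 := lt0r_neq0 r0; field.
Qed.

(** * The shortcut *)

Lemma cos_ge (R : realType) (x : R) : 0 <= x -> 1 - x ^+ 2 / 2 <= cos x.
Proof.
move=> x0; have -> : cos x = 1 - 2 * sin (x / 2) ^+ 2.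
  have {1}-> : x = (x / 2) *+ 2 by rewrite -mulr_natr; field.
  by rewrite cos_mulr2n sin2cos2; ring.
have : `|sin (x / 2)| ^+ 2 <= (x / 2) ^+ 2.
  rewrite ler_pXn2r// ?nnegrE ?divr_ge0//.
  have := @sin_lipschitz R 0 (x / 2); rewrite sin0 !subr0; apply.
  by rewrite divr_ge0.
rewrite real_normK ?num_real// expr_div_n; lra.
Qed.

(** The sign e encodes the type of the first turn, so that both types are treated at once. *)
Lemma freqM_sign (R : realType) (e u : R) : e ^+ 2 = 1 -> freq (e * u) = freq u.
Proof. by move=> e1; rewrite /freq exprMn e1 mul1r. Qed.

(** Here [q] is the end of the half turn after rotation by psi, in the frame at the start of that
    rotation. The correction [p] is of order psi^2, so only the second coordinate moves to first
    order. *)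
Lemma turning_half_location (R : realType) (r e psi : R) :
  0 < r -> r <= 1 -> e ^+ 2 = 1 ->
  let q := turning (e * Umax r) (r * psi) *m
             location (turning (- (e * Umax r)) (r * pi)) in
  let k := Num.sqrt (1 - r ^+ 2) in
  let p := (1 - cos psi) * (r * (3 - 4 * r ^+ 2)) in
  (q 0 0 = 1 - r * (2 * r + p)) * (q 1 0 = sin psi * (r * (3 - 4 * r ^+ 2))) *
  (q 2 0 = - (e * (k * (2 * r - p)))).
Proof.
move=> r0 r1 e1 q k p.
have r00 := lt0r_neq0 r0.
have k2 : k ^+ 2 = 1 - r ^+ 2 by rewrite sqr_sqrtr// subr_ge0 expr_le1// ltW.
have fU : freq (e * Umax r) = r^-1 by rewrite freqM_sign// freq_Umax.
have fNU : freq (- (e * Umax r)) = r^-1.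
  by rewrite -mulN1r freqM_sign// sqrrN expr1n.
have e0 : e * (e * (k * k)) = 1 - r ^+ 2.
  by rewrite mulrA -expr2 e1 mul1r -expr2.
rewrite /q !turning_mulE fU !spin_mulE.
move: (location_turning (- (e * Umax r)) (r * pi)).
rewrite fNU !mulKf// cospi sinpi => /= lE; rewrite !lE {lE} /Umax -/k /p.
(* Each coordinate identity holds modulo e^2 k^2 = 1 - r^2; the cofactor [z] is supplied explicitly
   below. *)
have addE (x y z : R) : x - y = (e * (e * (k * k)) - (1 - r ^+ 2)) * z -> x = y.
  by rewrite e0 subrr mul0r => /subr0_eq.
split; [split|].
- by apply: (addE _ _ (- (2 * (1 - cos psi) * r ^+ 2))); field.
- by apply: (addE _ _ (2 * sin psi * r)); field.
- by apply: (addE _ _ (2 * (1 - cos psi) * r * e * k)); field.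
Qed.

(** Everything is expressed in the frame where the shortened first arc ends, so the initial
    configuration does not occur; the witnesses precede e and serve both types of path. *)
Lemma exists_shortcut (R : realType) (r alpha : R) :
  0 < r -> r <= Num.sqrt 3 / 2 -> 0 < alpha -> exists v s psi,
  [/\ `|v| <= Umax r, 0 <= s, 0 <= psi <= alpha,
    s + r * (alpha - psi) < r * alpha + r * pi &
    forall e, e ^+ 2 = 1 -> location (turning (- (e * v)) s) =
      turning (e * Umax r) (r * psi) *m
        location (turning (- (e * Umax r)) (r * pi))].
Proof.
move=> r0 rle a0.
have s32 : Num.sqrt 3 ^+ 2 = 3 :> R by rewrite sqr_sqrtr.
have D0 : 0 <= 3 - 4 * r ^+ 2.
  have : r ^+ 2 <= (Num.sqrt 3 / 2) ^+ 2.
    by rewrite ler_pXn2r// nnegrE ?divr_ge0 ?sqrtr_ge0// ltW.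
  by rewrite expr_div_n s32; lra.
have r1 : r <= 1 by nra.
(* With y >= 1 - 3 psi^2 and pi <= 4, the gain (pi + psi) y - pi is at least psi (1 - 12 psi - 3
   psi^2), which is positive for psi <= 1 / 32. *)
pose psi := Num.min alpha 32^-1.
have psi0 : 0 < psi by rewrite lt_min a0 invr_gt0 ltr0n.
have psia : psi <= alpha by rewrite ge_min lexx.
have psi1 : psi <= 32^-1 by rewrite ge_min lexx orbT.
have C2 := cos_ge (ltW psi0); have C1 := cos_le1 psi.
have S0 : 0 <= sin psi.
  apply: sin_ge0_pi; rewrite ltW//= (le_trans psi1)//.
  by rewrite (le_trans _ (pi_ge2 R))//; lra.
set C := cos psi in C1 C2.
set k := Num.sqrt (1 - r ^+ 2).
have k0 : 0 <= k by exact: sqrtr_ge0.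
have k2 : k ^+ 2 = 1 - r ^+ 2 by rewrite sqr_sqrtr// subr_ge0 expr_le1// ltW.
set D := 3 - 4 * r ^+ 2 in D0.
have D3 : D <= 3 by rewrite /D; have := sqr_ge0 r; lra.
pose p := (1 - C) * (r * D).
have p0 : 0 <= p by rewrite mulr_ge0 ?subr_ge0// mulr_ge0// ltW.
have rp0 : 0 < 2 * r + p by lra.
(* v and the h below solve 1 - h = x and v h = - z, where x and z are the first
   and third coordinates in [turning_half_location] (for e = 1). *)
pose v := Umax r * ((2 * r - p) / (2 * r + p)).
pose h := r * (2 * r + p).
have h0 : 0 < h by rewrite mulr_gt0.
have vh : v * h = k * (2 * r - p).
  by rewrite /v /h /Umax -/k; field; rewrite !lt0r_neq0.
pose W := freq v.
have W0 : 0 < W := freq_gt0 v.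
have W2 : W ^+ 2 = 1 + v ^+ 2 := sqr_freq v.
(* The target is a unit vector: its second coordinate squared is 1 - (1 - h)^2 - (v h)^2. This
   bounds [h * W ^+ 2] by 2 and makes the arccosine below meaningful. *)
have hW : h * (2 - h * W ^+ 2) = (sin psi * (r * D)) ^+ 2.
  have -> : h * (2 - h * W ^+ 2) = 2 * h - h ^+ 2 - (v * h) ^+ 2.
    by rewrite W2; ring.
  rewrite vh !exprMn k2 sin2cos2 -/C /h /p /D; ring.
have hW2 : 0 <= 2 - h * W ^+ 2.
  by rewrite -(pmulr_rge0 _ h0) hW sqr_ge0.
have hW0 : 0 < h * W ^+ 2 by rewrite mulr_gt0// exprn_gt0.
have cI : -1 <= 1 - h * W ^+ 2 <= 1 by apply/andP; split; lra.
(* Turning angle of the shortcut. It lies between 0 and pi, so its sine is nonnegative like the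
   second coordinate of the target, whose sign is that of [D]. *)
pose b := acos (1 - h * W ^+ 2).
have W00 := lt0r_neq0 W0.
have X0 : 0 <= sin psi * (r * D) by rewrite mulr_ge0// mulr_ge0// ltW.
have sb : sin b / W = sin psi * (r * D).
  rewrite sin_acos//.
  have -> : 1 - (1 - h * W ^+ 2) ^+ 2 = (W * (sin psi * (r * D))) ^+ 2.
    by rewrite exprMn -hW; ring.
  by rewrite sqrtr_sqr ger0_norm ?(mulr_ge0 (ltW W0) X0)// mulrC mulKf.
exists v, (b / W), psi; split.
- rewrite /v normrM ger0_norm ?divr_ge0 ?(ltW r0)//.
  rewrite ler_piMr ?divr_ge0 ?(ltW r0)//.
  by rewrite normrM normfV (gtr0_norm rp0) ler_pdivrMr// mul1r ler_norml; lra.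
- by apply: divr_ge0; [exact: acos_ge0|exact: ltW].
- by rewrite ltW.
- have b_pi : b <= pi by exact: acos_lepi.
  (* Ratio of r to the shortcut radius 1 / [W]. As [b <= pi], the length inequality follows from pi
     < (pi + psi) y. *)
  pose y := r * W.
  have y0 : 0 < y by rewrite mulr_gt0.
  pose q := (2 * r - p) / (2 * r + p).
  have y2 : y ^+ 2 = 1 - k ^+ 2 * (1 - q ^+ 2).
    have -> : y ^+ 2 = r ^+ 2 + (k * q) ^+ 2.
      by rewrite /y exprMn W2 /v -/q /Umax -/k; field; rewrite lt0r_neq0.
    by rewrite exprMn k2; ring.
  (* With p = r w one has q = (2 - w) / (2 + w) >= 1 - w, hence 1 - y^2 <= 2 w <= 3 psi^2; a lower
     bound at most 1 for y^2 is also one for the positive y. *)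
  have ylow : 1 - 3 * psi ^+ 2 <= y.
    pose w := (1 - C) * D.
    have w0 : 0 <= w by rewrite mulr_ge0// subr_ge0.
    have w3 : w <= 3 / 2 * psi ^+ 2 by rewrite /w; nra.
    have psi2 : psi ^+ 2 <= 32^-1 by nra.
    have qw : 1 - w <= q.
      rewrite ler_pdivlMr// (_ : p = r * w); last by rewrite /p /w; ring.
      have : 0 <= r * w ^+ 2 by rewrite mulr_ge0 ?sqr_ge0// ltW.
      by lra.
    have q2 : 1 - 2 * w <= q ^+ 2 by nra.
    have qq : k ^+ 2 * (1 - q ^+ 2) <= 3 * psi ^+ 2.
      by have := sqr_ge0 r; have := sqr_ge0 k; nra.
    have : 1 - 3 * psi ^+ 2 <= y ^+ 2 by rewrite y2; lra.
    nra.
  have pi4 : pi <= 4 :> R by have := pihalf_lt2 R; lra.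
  rewrite -(ltr_pM2r W0) mulrDl divfK// mulrDl.
  have : pi < (pi + psi) * y.
    have := pi_gt0 R; nra.
  rewrite /y; nra.
- move=> e e1; have fE : freq (- (e * v)) = W.
    by rewrite -mulN1r freqM_sign ?sqrrN ?expr1n// freqM_sign.
  have := location_turning (- (e * v)) (b / W).
  rewrite fE [W * _]mulrC divfK// sb acosK ?in_itv//= => lE.
  have qE := turning_half_location psi r0 r1 e1.
  have hE : (1 - (1 - h * W ^+ 2)) / W ^+ 2 = h by field.
  apply/matrixP => i j; rewrite ord1; move: i; apply: ord3_ind.
  + by rewrite lE qE hE.
  + by rewrite lE qE.
  + by rewrite lE qE hE mulNr -mulrA vh.
Qed.

(** * End point of the given path and comparison with the shortcut *)

Definition turn_sign (R : realType) (c : turn) : R :=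
  match c with Left => 1 | Right => -1 end.

Lemma turn_controlE (R : realType) (r : R) c :
  turn_control r c = turn_sign R c * Umax r.
Proof. by case: c; rewrite /= ?mul1r ?mulN1r. Qed.

Lemma turn_control_opposite (R : realType) (r : R) c :
  turn_control r (opposite c) = - turn_control r c.
Proof. by case: c; rewrite /= ?opprK. Qed.

(** The control is constant inside each segment, and absolute continuity and the equations restrict
    to subintervals, so [turning_unique] applies twice. *)
Lemma CC_path_end (R : realType) (r alpha beta : R) c (g0 : 'M[R]_3) g :
  0 < r -> 0 <= alpha -> 0 <= beta -> CC_path r c alpha beta g0 g ->
  g (r * alpha + r * beta) = g0 *m turning (turn_control r c) (r * alpha)
    *m turning (- turn_control r c) (r * beta).
Proof.
move=> r0 a0 b0 [u [[L0 _ [gSO acg] g0E gae] u1 u2]].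
have ra : 0 <= r * alpha by rewrite mulr_ge0// ltW.
have rb : 0 <= r * beta by rewrite mulr_ge0// ltW.
have segment a b k : 0 <= a -> a <= b -> b <= r * alpha + r * beta ->
    (forall s, a < s < b -> u s = k) -> g b = g a *m turning k (b - a).
  move=> a0' ab bL uk; apply: turning_unique => //.
  - move=> e e0; have [d d0 acd] := acg e e0; exists d => // n I Iab.
    apply: acd => i; have [? [? ?]] := Iab i.
    by split; [exact: le_trans a0' _|split=> //; exact: le_trans bL].
  - move=> s /andP[as_ sb]; apply: gSO.
    by rewrite (le_trans a0')//= (le_trans sb).
  - apply: negligibleS gae; apply: subsetC => s /= gs sab.
    rewrite -(uk s sab); apply/dubins_ode_atP/gs.
    by case/andP: sab => as_ sb; rewrite (le_lt_trans a0')//= (lt_le_trans sb).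
rewrite (segment (r * alpha) _ (- turn_control r c)) ?lerDl//; last first.
  by move=> s sab; rewrite u2// turn_control_opposite.
rewrite (segment 0 _ (turn_control r c)) ?lerDl//.
by rewrite g0E subr0 addrC addKr.
Qed.

Theorem lemma7 (R : realType) (r alpha : R)
    (r_gt0 : 0 < r) (r_le : r <= Num.sqrt 3 / 2)
    (alpha_gt0 : 0 < alpha) (alpha_le : alpha <= pi)
    (c : turn) (g0 : 'M[R]_3) (g0_SO3 : SO3 g0) (g : R -> 'M[R]_3) :
  CC_path r c alpha pi g0 g ->
  non_optimal r (r * alpha + r * pi) g0 g.
Proof.
move=> ccg; have gE := CC_path_end r_gt0 (ltW alpha_gt0) (pi_ge0 R) ccg.
have [v [s [psi [vU s0 /andP[psi0 psia] short loc]]]] :=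
  exists_shortcut r_gt0 r_le alpha_gt0.
set e := turn_sign R c.
have e1 : e ^+ 2 = 1 by rewrite /e; case: (c); rewrite /= ?sqrrN expr1n.
have ne : `|e| = 1 by rewrite /e; case: (c); rewrite /= ?normrN normr1.
have U0 : 0 <= Umax r by exact: le_trans vU.
have [|||| g' adm g'E] := @turning_pair_admissible R r (r * (alpha - psi)) s
    (e * Umax r) (- (e * v)) g0 g0_SO3.
- by rewrite mulr_ge0 ?subr_ge0// ltW.
- by [].
- by rewrite normrM ne mul1r ger0_norm.
- by rewrite normrN normrM ne mul1r.
exists (r * (alpha - psi) + s), g'; split=> //; first by rewrite addrC.
(* The turnings by [r * (alpha - psi)] and [r * psi] recombine into the whole first arc, so the end
   points coincide. *)
rewrite g'E gE turn_controlE -/e !mulmx_location loc// mulmxA.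
by rewrite -(mulmxA g0) -turningD mulrBr subrK.
Qed.
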